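(* $\mathrm{S}^{=}$ is not closed under Kleene closure.
   Context: Let $\Gamma=\Sigma\cup\{¢,\$\}$, where ¢ and \$ are left and right end-markers. A PFA $\mathcal{P}=(S,\Sigma,\{\mathsf{A}_\sigma:\sigma\in\Gamma\},F)$ has states $S=\{s_1,\dots,s_n\}$ (start state $s_1$), real stochastic $n\times n$ transition matrices $\mathsf{A}_\sigma$, and accepting states $F$; its acceptance probability on $w\in\Sigma^*$ is $f_{\mathcal{P}}(w)=\sum_{s_i\in F}\mathsf{v}(i)$, where $\mathsf{v}=(1,0,\dots,0)\mathsf{A}_{¢}\mathsf{A}_{w_1}\cdots\mathsf{A}_{w_{|w|}}\mathsf{A}_{\$}$. $\mathrm{S}^{=}$ is the class of languages of the form $\{w: f_{\mathcal{P}}(w)=\lambda\}$ for some PFA $\mathcal{P}$ and $\lambda\in[0,1]$. *)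

(* Defs.v *)
From HB Require Import structures.
From mathcomp Require Import all_boot all_order all_algebra.
From mathcomp Require Import classical_sets reals.

Set Implicit Arguments.
Unset Strict Implicit.
Unset Printing Implicit Defensive.

Import Order.TTheory GRing.Theory Num.Theory.
Local Open Scope classical_set_scope.
Local Open Scope ring_scope.

Inductive tape_symbol (Sigma : Type) : Type :=
| Sym of Sigma
| LeftMarker
| RightMarker.

Arguments LeftMarker {Sigma}.
Arguments RightMarker {Sigma}.

(* Distributions are row vectors acted on from the right, so it is the rows
   that sum to 1. *)
Definition stochastic (R : realType) (n : nat) (A : 'M[R]_n) : Prop :=
  (forall i j, 0 <= A i j) /\ (forall i, \sum_j A i j = 1).

(* The number of states is [pfa_size.+1]; the start state is [ord0]. *)
Record pfa (R : realType) (Sigma : finType) : Type := Pfa {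
  pfa_size : nat;
  pfa_trans : tape_symbol Sigma -> 'M[R]_pfa_size.+1;
  pfa_final : {set 'I_pfa_size.+1};
  pfa_stochastic : forall g, stochastic (pfa_trans g)
}.

Section Acceptance.
Variables (R : realType) (Sigma : finType).

Definition final_vector (P : pfa R Sigma) (w : seq Sigma)
    : 'rV[R]_(pfa_size P).+1 :=
  delta_mx 0 ord0 *m pfa_trans P LeftMarker
    *m (\prod_(a <- w) pfa_trans P (Sym a))
    *m pfa_trans P RightMarker.

Definition acceptance (P : pfa R Sigma) (w : seq Sigma) : R :=
  \sum_(i in pfa_final P) final_vector P w 0 i.

(* The class S^= over the alphabet Sigma. *)
Definition exact_stochastic (L : set (seq Sigma)) : Prop :=
  exists (P : pfa R Sigma) (lambda : R),
    0 <= lambda <= 1 /\ L = [set w | acceptance P w = lambda].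

End Acceptance.

Arguments exact_stochastic R {Sigma} L.

Definition kleene_closure (Sigma : eqType) (L : set (seq Sigma))
    : set (seq Sigma) :=
  [set w | exists ws : seq (seq Sigma),
     (forall u, u \in ws -> L u) /\ w = flatten ws].

(* Main.v *)
(** Let d(w) be the number of b's minus the number of a's in w. The language
    L = {w : d(w) = 0 or d(w) = 1} is in S^=: with x = 2^-#a and y = 2^-#b it is
    the zero set of (x - y)(x - 2y) = x^2 - 3xy + 2y^2, a combination of three
    monomials each computed by one decaying state. Since d is additive, a^i b^j
    lies in L^* exactly when i <= j. If L^* were in S^=, the matrix
    f(a^(i+1) b^j) - lambda would be triangular with nonzero diagonal for every
    size, whereas its rank is bounded in terms of the number of states. *)
Require Import Defs.
From mathcomp Require Import all_boot all_order all_algebra.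
From mathcomp Require Import classical_sets reals.
From mathcomp Require Import zify ring lra.

Set Implicit Arguments.
Unset Strict Implicit.
Unset Printing Implicit Defensive.

Import Order.TTheory GRing.Theory Num.Theory.
Local Open Scope ring_scope.

(** The matrix factors through the state space: row i of [U] is the state distribution after the
    left marker and [x i], and column j of [V] gives the probability of accepting from each state on
    [y j] and the right marker. *)
Lemma acceptance_rank (R : realType) (Sigma : finType) (P : pfa R Sigma)
    (m : nat) (x y : 'I_m -> seq Sigma) :
  (\rank (\matrix_(i, j) acceptance P (x i ++ y j)) <= (pfa_size P).+1)%N.
Proof.
pose U := \matrix_i (delta_mx 0 ord0 *m pfa_trans P LeftMarker
    *m \prod_(a <- x i) pfa_trans P (Sym a)).
pose V := \matrix_(k, j) \sum_(l in pfa_final P)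
    ((\prod_(a <- y j) pfa_trans P (Sym a)) *m pfa_trans P RightMarker) k l.
suff -> : \matrix_(i, j) acceptance P (x i ++ y j) = U *m V.
  by apply: leq_trans (mxrankM_maxr _ _) _; apply: rank_leq_row.
apply/matrixP => i j.
rewrite mxE [RHS]mxE /acceptance /final_vector big_cat /=.
under [RHS]eq_bigr do rewrite [U _ _]mxE [V _ _]mxE mulr_sumr.
rewrite [RHS]exchange_big /=; apply: eq_bigr => l _.
by rewrite -mulmxE mulmxA -(mulmxA _ _ (pfa_trans P RightMarker)) mxE.
Qed.

(** Acceptance minus [lambda] vanishes exactly on L, so these hypotheses make its matrix lower
    triangular and invertible, of rank m. Subtracting the constant adds at most one to the rank
    bound. *)
Lemma exact_stochastic_triangular (R : realType) (Sigma : finType)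
    (L : set (seq Sigma)) :
  exact_stochastic R L ->
  exists N : nat, forall (m : nat) (x y : 'I_m -> seq Sigma),
    (forall i, ~ L (x i ++ y i)) ->
    (forall i j : 'I_m, (i < j)%N -> L (x i ++ y j)) -> (m <= N)%N.
Proof.
move=> [P [lambda [_ ->]]]; exists (pfa_size P).+2 => m x y Ldiag Lupper.
pose A := \matrix_(i, j) acceptance P (x i ++ y j).
pose C : 'M[R]_m := const_mx (- lambda).
have trigAC : is_trig_mx (A + C).
  by apply/is_trig_mxP => i j /Lupper /= e; rewrite !mxE e subrr.
have unitAC : A + C \in unitmx.
  rewrite unitmxE det_trig // unitfE; apply/prodf_neq0 => i _.
  by rewrite !mxE subr_eq0; apply/eqP; apply: Ldiag.
have rankC : (\rank C <= 1)%N.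
  have -> : C = const_mx (- lambda) *m (const_mx 1 : 'rV_m).
    by apply/matrixP => i j; rewrite !mxE big_ord1 !mxE mulr1.
  by apply: leq_trans (mxrankM_maxr _ _) _; apply: rank_leq_row.
rewrite -(mxrank_unit unitAC) -[(pfa_size P).+2]addn1.
by apply: leq_trans (mxrank_add _ _) _; rewrite leq_add ?acceptance_rank.
Qed.

(** State i survives with probability [p i] and otherwise drops into [ord_max], which is absorbing
    whatever [p ord_max] is. Hence survival probabilities simply multiply along a word. *)
Definition decay_mx (R : realType) (n : nat) (p : 'I_n.+1 -> R) : 'M[R]_n.+1 :=
  \matrix_(i, j) (p i *+ (i == j) + (1 - p i) *+ (j == ord_max)).

Section Decay.
Variables (R : realType) (n : nat).
Implicit Types p q : 'I_n.+1 -> R.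

Lemma sum_mulrn_eq (f : 'I_n.+1 -> R) (k : 'I_n.+1) :
  \sum_j f j *+ (j == k) = f k.
Proof.
rewrite (bigD1 k) //= eqxx big1 ?addr0 // => j /negPf ->.
by rewrite mulr0n.
Qed.

Lemma mul_row_decay (v : 'I_n.+1 -> R) p i :
  \sum_j decay_mx p i j * v j = p i * v i + (1 - p i) * v ord_max.
Proof.
rewrite -(sum_mulrn_eq (fun j => p i * v j) i).
rewrite -(sum_mulrn_eq (fun j => (1 - p i) * v j) ord_max) -big_split /=.
by apply: eq_bigr => j _; rewrite mxE mulrDl !mulrnAl [i == j]eq_sym.
Qed.

Lemma decay_mx_stochastic p :
  (forall i, 0 <= p i <= 1) -> stochastic (decay_mx p).
Proof.
move=> p01; split=> [i j | i].
  by have /andP[p0 p1] := p01 i; rewrite mxE addr_ge0 ?mulrn_wge0 ?subr_ge0.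
have := mul_row_decay (fun=> 1) p i.
by under eq_bigr do rewrite mulr1; move=> ->; ring.
Qed.

Lemma decay_mxM p q :
  decay_mx p *m decay_mx q = decay_mx (fun i => p i * q i).
Proof.
apply/matrixP => i j; rewrite mxE (mul_row_decay (fun k => decay_mx q k j)) !mxE.
rewrite [ord_max == j]eq_sym.
by case: (i == j); case: (j == ord_max); rewrite ?mulr1n ?mulr0n; ring.
Qed.

Lemma prod_decay_mx (T : Type) (p : T -> 'I_n.+1 -> R) (w : seq T) :
  \prod_(a <- w) decay_mx (p a) = decay_mx (fun i => \prod_(a <- w) p a i).
Proof.
elim: w => [|a w IHw].
  rewrite big_nil; apply/matrixP => i j.
  by rewrite !mxE !big_nil subrr mul0rn addr0.
rewrite big_cons IHw -mulmxE decay_mxM; apply/matrixP => i j.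
by rewrite !mxE big_cons.
Qed.

End Decay.

(* The letter a is [false] and the letter b is [true]. *)
Definition excess01 : set (seq bool) :=
  [set w | count_mem true w = count_mem false w \/
           count_mem true w = (count_mem false w).+1]%classic.

Section ExcessPfa.
Variable R : realType.

(** Over a word, states 0, 1, 2 accumulate the monomials x^2, xy, y^2; state 3 is the absorbing
    one. *)
Definition rate (c : bool) (i : 'I_4) : R :=
  2^-1 ^+ nth 0%N [:: (~~ c).*2; 1; c.*2; 0]%N i.

(* The weights 1/6, 1/2, 1/3 are the absolute values of the coefficients
   1, -3, 2, normalized; the sign is implemented by accepting or rejecting, and
   the absorbing state contributes one half of the lost mass. *)
Definition left_row (j : 'I_4) : R := nth 0 [:: 6^-1; 2^-1; 3^-1; 0] j.

Definition right_accept (i : 'I_4) : R := nth 0 [:: 1; 0; 1; 2^-1] i.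

Definition excess_trans (g : tape_symbol bool) : 'M[R]_4 :=
  match g with
  | Sym c => decay_mx (rate c)
  | LeftMarker => \matrix_(i, j) left_row j
  | RightMarker =>
      \matrix_(i, j) (right_accept i *+ (j == ord0)
                      + (1 - right_accept i) *+ (j == ord_max))
  end.

Lemma rate01 c i : 0 <= rate c i <= 1.
Proof. by rewrite exprn_ge0 ?exprn_ile1 ?invr_ge0 ?invf_le1 ?ler1n. Qed.

Lemma excess_trans_stochastic g : stochastic (excess_trans g).
Proof.
case: g => [c | | ] /=.
- exact: decay_mx_stochastic (rate01 c).
- split=> [i j | i]; last first.
    under eq_bigr do rewrite mxE.
    by rewrite !big_ord_recl big_ord0 /left_row /=; field.
  rewrite mxE; case: j => -[|[|[|[|//]]]] lt_j;
    by rewrite /left_row /= ?invr_ge0 ?ler0n.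
- have right01 i : 0 <= right_accept i <= 1.
    by case: i => -[|[|[|[|//]]]] lt_i; rewrite /right_accept /=; lra.
  split=> [i j | i].
    by have /andP[r0 r1] := right01 i;
      rewrite mxE addr_ge0 ?mulrn_wge0 ?subr_ge0.
  under eq_bigr do rewrite mxE.
  by rewrite big_split /= !(sum_mulrn_eq (fun=> _)); ring.
Qed.

Definition excess_pfa : pfa R bool := Pfa [set ord0] excess_trans_stochastic.

Lemma prod_rate (w : seq bool) (i : 'I_4) :
  \prod_(c <- w) rate c i =
  2^-1 ^+ nth 0%N [:: (count_mem false w).*2; size w;
                      (count_mem true w).*2; 0]%N i.
Proof.
elim: w => [|c w IHw].
  by rewrite big_nil; case: i => -[|[|[|[|//]]]] lt_i.
rewrite big_cons IHw /rate -exprD; congr (_ ^+ _).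
by case: i {IHw} => -[|[|[|[|//]]]] lt_i; case: c => /=; lia.
Qed.

(** A state of weight c and surviving mass m contributes c (m r + (1 - m)/2) = c/2 + c m (r - 1/2),
    with r its [right_accept] value. The weights sum to 1, so the cutpoint is 1/2. *)
Lemma acceptance_excess_pfa (w : seq bool) :
  acceptance excess_pfa w =
  2^-1 + (2^-1 ^+ count_mem false w - 2^-1 ^+ count_mem true w)
         * (2^-1 ^+ count_mem false w - 2 * 2^-1 ^+ count_mem true w) / 12.
Proof.
rewrite /acceptance big_set1 /final_vector /= prod_decay_mx -rowE -mulmxA mxE.
under eq_bigr => k _.
  rewrite mxE [(\matrix_(_, _) left_row _) _ _]mxE mxE.
  rewrite (mul_row_decay (fun j => (\matrix_(i, j) _) j ord0)).
  rewrite !mxE /= !mulr0n !addr0 !mulr1n prod_rate.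
  over.
(* The length is split as #b + #a, so that the middle monomial becomes xy. *)
rewrite -(count_predC (pred1 true) w).
rewrite (@eq_count _ (predC (pred1 true)) (pred1 false)); last by case.
rewrite !big_ord_recl big_ord0 /left_row /right_accept /= -!addnn !exprD.
set x := _ ^+ count_mem false w; set y := _ ^+ count_mem true w.
by field.
Qed.

Lemma exact_stochastic_excess01 : exact_stochastic R excess01.
Proof.
exists excess_pfa, 2^-1; split; first lra.
apply/seteqP; split=> w /=; rewrite acceptance_excess_pfa.
  by case=> ->; rewrite ?exprS; field.
have inj2 : injective (GRing.exp (2^-1 : R)).
  by apply: ieexprIn; rewrite ?invr_gt0 ?ltr0n ?invr_eq1 ?(eqr_nat R 2 1).
move=> eq0; have /eqP : (2^-1 ^+ count_mem false w - 2^-1 ^+ count_mem true w)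
  * (2^-1 ^+ count_mem false w - 2^-1 ^+ count_mem true w * 2) = 0 :> R by lra.
rewrite mulf_eq0 !subr_eq0 => /orP[] /eqP eq2.
  by left; apply/esym/inj2.
by right; apply: inj2; rewrite exprS eq2; field.
Qed.

End ExcessPfa.

Lemma nseq_kleene_excess01 (i j : nat) :
  kleene_closure excess01 (nseq i false ++ nseq j true) <-> (i <= j)%N.
Proof.
split=> [[ws [Lws e]] | le_ij].
  (* Every factor has d >= 0, and this is preserved by concatenation. *)
  have le_ws : (count_mem false (flatten ws) <= count_mem true (flatten ws))%N.
    elim: ws Lws {e} => //= u ws IHws Lws; rewrite !count_cat leq_add //.
      by case: (Lws u (mem_head _ _)) => ->.
    by apply: IHws => v ws_v; apply: Lws; rewrite inE ws_v orbT.
  by move: le_ws; rewrite -e !count_cat !count_nseq /=; lia.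
(* One balanced factor (d = 0), then each surplus b as its own factor (d = 1). *)
exists ((nseq i false ++ nseq i true) :: nseq (j - i) [:: true]); split.
  move=> u; rewrite inE mem_nseq => /orP[/eqP -> | /andP[_ /eqP ->]].
    by left; rewrite !count_cat !count_nseq /=; lia.
  by right.
have flatten_nseq1 n : flatten (nseq n [:: true]) = nseq n true.
  by elim: n => //= n ->.
by rewrite /= flatten_nseq1 -catA -nseqD subnKC.
Qed.

Theorem theorem5p4 (R : realType) :
  ~ (forall (Sigma : finType) (L : set (seq Sigma)),
       exact_stochastic R L -> exact_stochastic R (kleene_closure L)).
Proof.
move/(_ _ _ (exact_stochastic_excess01 R))/exact_stochastic_triangular => [N].
(* The shift to i + 1 puts the diagonal just outside the closure, while i < j still gives i + 1 <=
   j. *)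
move/(_ N.+1 (fun i => nseq i.+1 false) (fun j => nseq j true)).
rewrite ltnn => tri; suff: false by [].
apply: tri => [i | i j lt_ij].
  by rewrite nseq_kleene_excess01 ltnn.
by rewrite nseq_kleene_excess01.
Qed.
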